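(* Let $\Bbbk$ be a field, let $m\ge 2$ be an integer, let $R=\Bbbk[x_{1,i},x_{2,i},x_{3,i}:1\le i\le 2m-1]$, and for each $1\le j\le 3$ let $I_j$ be the ideal generated by all products of $m$ distinct variables among the $2m-1$ variables $x_{j,1},\ldots,x_{j,2m-1}$: $$I_j=(x_{j,i_1}x_{j,i_2}\cdots x_{j,i_m}:1\le i_1<i_2<\cdots<i_m\le 2m-1).$$ Denote $P_m=I_1+I_2+I_3\subseteq R$. Then $\rho(P_m)\ge \frac{3m}{4}$ and $\rho_a(P_m)=\frac{m^2}{2m-1}$. In particular, $\frac{2m^2-3m}{4(2m-1)}\le \rho(P_m)-\rho_a(P_m)$, so $\lim_{m\to\infty}(\rho(P_m)-\rho_a(P_m))=\infty$.
   Context: For an ideal $I$ of a noetherian ring $A$ and $n\ge 1$, the $n$-th symbolic power (defined via associated primes) is $I^{(n)}=\bigcap_{\mathfrak p\in \operatorname{Ass}(I)}(I^nA_{\mathfrak p}\cap A)$, where $\operatorname{Ass}(I)$ is the set of associated primes of $A/I$ and $I^nA_{\mathfrak p}\cap A$ is the preimage of $I^nA_{\mathfrak p}$ in $A$. For a nonzero proper homogeneous ideal $I$ in a standard graded polynomial ring (finitely many variables of degree 1), the resurgence and asymptotic resurgence are $$\rho(I)=\sup\left\{\tfrac{m}{r}: I^{(m)}\not\subseteq I^r,\ m\ge 1,\ r\ge 1\right\},\qquad \rho_a(I)=\sup\left\{\tfrac{m}{r}: I^{(mt)}\not\subseteq I^{rt}\ \text{for all } t\gg 0\right\},$$ where $m,r$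 range over positive integers. *)

(* Defs.v *)
From HB Require Import structures.
From mathcomp Require Import all_boot all_order all_algebra.
From mathcomp Require Import fraction ring_quotient.
From mathcomp Require Import all_classical all_reals all_analysis.
(* Some notations of mpoly clash with those of analysis. *)
From mathcomp Require Import -(notations) mpoly.

Set Implicit Arguments.
Unset Strict Implicit.
Unset Printing Implicit Defensive.

Import Order.TTheory GRing.Theory Num.Theory.
Import numFieldNormedType.Exports.

Local Open Scope classical_set_scope.
Local Open Scope ring_scope.

Section Ideals.
Variable A : idomainType.
Implicit Types (S I J p : set A) (n : nat).

Definition ideal_gen S : set A :=
  [set f | exists (n : nat) (a g : 'I_n -> A),
     (forall i, S (g i)) /\ f = \sum_(i < n) a i * g i].

Definition ideal_add I J : set A := [set f + g | f in I & g in J].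

Definition ideal_exp I n : set A :=
  ideal_gen [set f | exists g : 'I_n -> A,
     (forall i, I (g i)) /\ f = \prod_(i < n) g i].

(* [idealr_closed] includes 1 \notin p *)
Definition prime_ideal p : Prop :=
  idealr_closed (mem p) /\ prime_idealr_closed (mem p).

(* [set a | I (a * x)] is the annihilator of the class of x in A / I *)
Definition Ass I : set (set A) :=
  [set p | prime_ideal p /\ exists x, p = [set a | I (a * x)]].

(* A being a domain, its localization at the prime p is realized as a subring
   of the field of fractions of A. *)
Definition localization p : set {fraction A} :=
  [set (FracField.tofrac a / FracField.tofrac s) | a in setT & s in ~` p].

(* the ideal J A_p of A_p generated by the image of J *)
Definition local_ext p J : set {fraction A} :=
  [set z | exists (n : nat) (u : 'I_n -> {fraction A}) (g : 'I_n -> A),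
     [/\ forall i, localization p (u i), forall i, J (g i) &
         z = \sum_(i < n) u i * FracField.tofrac (g i)]].

Definition symbolic_power I n : set A :=
  \bigcap_(p in Ass I)
    (@FracField.tofrac A @^-1` local_ext p (ideal_exp I n)).

(* Suprema are taken in the extended reals, so that no boundedness is
   presupposed. *)
Definition resurgence (R : realType) I : \bar R :=
  ereal_sup [set e | exists m r : nat,
    [/\ (1 <= m)%N, (1 <= r)%N,
        ~ symbolic_power I m `<=` ideal_exp I r &
        e = (m%:R / r%:R)%:E]].

Definition asymptotic_resurgence (R : realType) I : \bar R :=
  ereal_sup [set e | exists m r : nat,
    [/\ (1 <= m)%N, (1 <= r)%N,
        \forall t \near \oo,
          ~ symbolic_power I (m * t) `<=` ideal_exp I (r * t) &
        e = (m%:R / r%:R)%:E]].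

End Ideals.

Section Pm.
Variables (k : fieldType) (m : nat).

(* the polynomial ring in the variables x_(j,i), 3 blocks of 2m-1 of them *)
Definition polyR : idomainType := mpoly (3 * (2 * m - 1)) k.

Definition var (j : 'I_3) (i : 'I_(2 * m - 1)) : polyR :=
  mpolyX k (mnm1 (mxvec_index j i)).

Definition Iblock (j : 'I_3) : set polyR :=
  ideal_gen [set f | exists S : {set 'I_(2 * m - 1)},
     #|S| = m /\ f = \prod_(i in S) var j i].

Definition Pm : set polyR :=
  ideal_add (ideal_add (Iblock (inord 0)) (Iblock (inord 1)))
            (Iblock (inord 2)).

End Pm.

Arguments var k m : clear implicits.
Arguments Iblock k m : clear implicits.
Arguments Pm k m : clear implicits.

(* Main.v *)
Require Import Defs.
From mathcomp Require Import all_boot all_order all_algebra.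
From mathcomp Require Import all_classical all_reals all_analysis.
From mathcomp Require Import zify ring lra.
From mathcomp Require Import -(notations) mpoly.

(** Everything reduces to exponent vectors. Write [N = 2m - 1], and write [P]
    for the ideal [P_m].

    For the symbolic powers, it is enough to localize at the primes [p_S]
    generated by [m] variables of each block (one [m]-subset [S j] for every
    block [j]): each is the annihilator modulo [P] of the product of the
    variables outside [S], hence is associated to [P] ([Ass_ordge]), and every
    associated prime lies in one of them, because a polynomial outside [P] has a
    monomial missing [m] variables of every block ([Ass_sub]). For the weight
    [w_S] counting the degree in the variables of [S], the least weight of a
    monomial of [f] is a valuation ([ordge_divr]), and it is at least [n] on
    [P^n]; conversely, if it is at least [n] at [f], then the product of [f]
    with some monomial in the variables outside [S] is in [P^n]
    ([ordge_compl_mon]). Hence [f] is in [P^(n)] if and only if every monomial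
    [a] of [f] satisfies [w_S(a) >= n] for all [S] ([symbolic_power_PmP]).

    Upper bound for [rho_a]. If block [j] of the exponent vector [a] satisfies
    [sum_i min(a_i, r_j) >= r_j m], then [r_j] generators of the block can be
    peeled off one at a time, so that [x^a] is in [P^(sum_j r_j)]
    ([peel_subset], [ideal_exp_Pm_mon]). If [s_j] is the sum of the [m] smallest
    exponents of block [j], the condition holds for [r_j] the integer part of
    [s_j N / m^2] ([min_subset]). As [sum_j s_j >= n] on [P^(n)], rounding costs
    at most 3, so [P^(n)] is in [P^r] once [(r + 3) m^2 <= n N]; this gives
    [P^(pt)] in [P^(rt)] for [t] large as soon as [p / r > m^2 / N].

    Lower bounds. The function [sum_j floor(deg_j(a) / m)], with [deg_j] the
    degree in block [j], is superadditive, and at least 1 on the monomials of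
    the elements of [P], hence at least [r] on those of the elements of [P^r]
    ([Pm_exp_degfloor]). The product of all variables lies in [P^(3m)], but the
    value there is 3, so it is not in [P^4]: this gives [rho >= 3m/4]. The power
    [q] of the product of the variables of a single block lies in [P^(mq)], and
    is not in [P^r] when [qN < rm]; this gives [rho_a >= m^2 / N]. *)

Import Order.TTheory GRing.Theory Num.Theory.
Import numFieldNormedType.Exports.

Set Implicit Arguments.
Unset Strict Implicit.
Unset Printing Implicit Defensive.

Local Open Scope ring_scope.

(** * Subsets of a finite set and truncated sums *)

Section FiniteSets.
Variable I : finType.
Implicit Types (A F S T : {set I}) (b : I -> nat).

Lemma subset_between F A n :
  F \subset A -> (#|F| <= n <= #|A|)%N ->
  exists T, [/\ F \subset T, T \subset A & #|T| = n].
Proof.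
move=> + /andP[+ nA]; move: {2}(n - #|F|)%N (leqnn (n - #|F|)) => d.
elim: d F => [|d IHd] F dF FA Fn.
  by exists F; split=> //; apply/eqP; rewrite eqn_leq Fn -subn_eq0 -leqn0.
have [Fn'|ltFn] := eqVneq #|F| n; first by exists F.
have /properP[_ [x Ax Fx]] : F \proper A.
  by rewrite properEcard FA; apply: leq_trans nA; rewrite ltn_neqAle ltFn.
have [|||T [FT TA Tn]] := IHd (x |: F).
- by rewrite cardsU1 Fx; move: dF; lia.
- by rewrite finset.subUset finset.sub1set Ax FA.
- by rewrite cardsU1 Fx; move: Fn ltFn; lia.
by exists T; split=> //; exact: fintype.subset_trans (finset.subsetUr _ _) FT.
Qed.

(** The condition [r m <= sum_i min(b_i, r)] says that the monomial with
    exponents [b] is a multiple of a product of [r] squarefree monomials of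
    degree [m]; this lemma splits off one of them. *)
Lemma peel_subset b r m : (r.+1 * m <= \sum_i minn (b i) r.+1)%N ->
  exists T, [/\ #|T| = m, forall i, i \in T -> (0 < b i)%N &
                (r * m <= \sum_i minn (b i - (i \in T)) r)%N].
Proof.
move=> rm; pose F := [set i | (r < b i)%N]; pose P := [set i | (0 < b i)%N].
(* Either T is inside F, whose elements alone keep the sum large, or T lies
   between F and P, and the truncated sum drops by exactly m. *)
have FP : F \subset P by apply/fintype.subsetP => i; rewrite !inE; lia.
have [mF|Fm] := leqP m #|F|.
  have [|T [_ TF Tm]] := @subset_between finset.set0 F m (finset.sub0set _).
    by rewrite cards0.
  exists T; split=> // [i /(fintype.subsetP TF)|]; first by rewrite inE; lia.
  rewrite -Tm mulnC -sum_nat_const big_mkcond /=; apply: leq_sum => i _.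
  by case: ifP => // /(fintype.subsetP TF); rewrite inE; lia.
have mP : (m <= #|P|)%N.
  rewrite -(leq_pmul2l (ltn0Sn r)); apply: leq_trans rm _.
  rewrite mulnC -sum_nat_const [leqRHS]big_mkcond /=; apply: leq_sum => i _.
  by rewrite inE; case: ifP; lia.
have [|T [FT TP Tm]] := @subset_between F P m FP; first by rewrite mP (ltnW Fm).
exists T; split=> // [i /(fintype.subsetP TP)|]; first by rewrite inE.
rewrite -(leq_add2r m) -mulSnr; apply: leq_trans rm _.
rewrite -[X in (_ + X)%N]Tm -sum1_card [X in (_ + X)%N]big_mkcond -big_split /=.
apply: leq_sum => i _; move/fintype.subsetP/(_ i): FT; rewrite inE.
case: (i \in T) => h; first lia.
by case: (ltnP r (b i)) h => [_ /(_ isT)|] //; lia.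
Qed.

(** An [m]-subset with least sum [s] controls all truncated sums:
    [r <= s (2 m - 1) / m ^ 2] implies [r m <= sum_i min(b_i, r)]. *)
Lemma min_subset b m : (0 < m)%N -> #|I| = (2 * m - 1)%N ->
  exists S, #|S| = m /\ forall r,
   (r * m ^ 2 <= (2 * m - 1) * \sum_(i in S) b i)%N ->
   (r * m <= \sum_i minn (b i) r)%N.
Proof.
move=> m0 cardI.
have [|S0 [_ _ S0m]] :=
    @subset_between finset.set0 finset.setT m (finset.sub0set _).
  by rewrite cards0 cardsT cardI; lia.
pose S := [arg min_(S < S0 | #|S| == m) \sum_(i in S) b i]%N.
have [Sm minS] : #|S| = m /\
    forall T, #|T| = m -> (\sum_(i in S) b i <= \sum_(i in T) b i)%N.
  rewrite /S; case: arg_minnP => [|T /eqP Tm minT]; first exact/eqP.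
  by split=> // U /eqP; apply: minT.
clearbody S; exists S; split=> // r hr.
(* x is a largest element of S for b; by minimality of S, an exchange shows that
   b is at least b x outside S. *)
have [x0 Sx0] : exists x, x \in S by apply/card_gt0P; rewrite Sm.
pose x := [arg max_(y > x0 in S) b y]%N.
have [Sx maxx] : x \in S /\ forall y, y \in S -> (b y <= b x)%N.
  by rewrite /x; case: arg_maxnP.
clearbody x.
have outS y : y \notin S -> (b x <= b y)%N.
  move=> Sy; have /minS : #|y |: (S :\ x)| = m.
    rewrite cardsU1 inE (negbTE Sy) andbF /=.
    by move: (cardsD1 x S); rewrite Sx Sm => ->.
  rewrite [leqLHS](bigD1 x) //= big_setU1 /=;
    last by rewrite inE (negbTE Sy) andbF.
  rewrite [X in (_ + X <= _)%N -> _](eq_bigl (mem (S :\ x))) ?leq_add2r //.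
  by move=> z; rewrite !inE andbC.
have cardC : #|~: S| = (m - 1)%N by rewrite cardsCs finset.setCK cardI Sm; lia.
have sumE (F : I -> nat) :
    (\sum_i F i = \sum_(i in S) F i + \sum_(i in ~: S) F i)%N.
  rewrite (bigID (mem S)) /=; congr (_ + _)%N.
  by apply: eq_bigl => i; rewrite inE.
have [rx|xr] := leqP r (b x).
  (* x and the m - 1 elements outside S already contribute r each. *)
  rewrite (bigID (mem (x |: ~: S))) /= -[leqLHS]addn0 leq_add //.
  have -> : (r * m = \sum_(i in x |: ~: S) r)%N.
    by rewrite sum_nat_const cardsU1 cardC !inE Sx /=; nia.
  apply: leq_sum => i; rewrite !inE => /orP[/eqP ->|/outS]; lia.
(* No truncation occurs on S, and each element outside S counts for at least
   b x, hence for at least the mean of b over S. *)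
have lo : (\sum_(i in S) b i + (m - 1) * b x <= \sum_i minn (b i) r)%N.
  rewrite sumE leq_add //.
    by apply: leq_sum => i /maxx; lia.
  rewrite -cardC -sum_nat_const; apply: leq_sum => i; rewrite inE => /outS; lia.
have hi : (\sum_(i in S) b i <= m * b x)%N.
  by rewrite -Sm -sum_nat_const; apply: leq_sum => i /maxx.
rewrite -(leq_pmul2l m0).
apply: leq_trans (_ : m * (r * m) <= r * m ^ 2)%N _; first nia.
apply: leq_trans hr _.
apply: leq_trans (_ : _ <= m * (\sum_(i in S) b i + (m - 1) * b x))%N _.
  by move: hi; nia.
by rewrite leq_pmul2l.
Qed.

End FiniteSets.

Local Open Scope classical_set_scope.

(** * Ideals, their powers and their localizations *)

Section IdealLemmas.
Variable A : idomainType.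
Implicit Types (S I J p : set A) (f g : A) (n : nat).

(** Ideals of [A], not necessarily proper. *)
Definition is_ideal I : Prop :=
  [/\ I 0, forall f g, I f -> I g -> I (f + g) & forall f g, I g -> I (f * g)].

Lemma is_ideal_sum I (T : Type) (r : seq T) (P : pred T) (F : T -> A) :
  is_ideal I -> (forall t, P t -> I (F t)) -> I (\sum_(t <- r | P t) F t).
Proof. by case=> I0 ID _ IF; apply: (big_ind I). Qed.

Lemma is_ideal_gen S : is_ideal (ideal_gen S).
Proof.
split.
- exists 0%N, (fun=> 0), (fun=> 0); split; first by case.
  by rewrite big_ord0.
- move=> f g [n1 [a1 [g1 [Sg1 ->]]]] [n2 [a2 [g2 [Sg2 ->]]]].
  exists (n1 + n2)%N.
  exists (fun i => match fintype.split i with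
                   | inl i1 => a1 i1 | inr i2 => a2 i2 end).
  exists (fun i => match fintype.split i with
                   | inl i1 => g1 i1 | inr i2 => g2 i2 end).
  split; first by move=> i; case: (fintype.split i).
  rewrite big_split_ord /=; congr (_ + _); apply: eq_bigr => i _.
    by rewrite (unsplitK (inl i)).
  by rewrite (unsplitK (inr i)).
- move=> f g [n [a [h [Sh ->]]]]; exists n, (fun i => f * a i), h; split=> //.
  by rewrite mulr_sumr; apply: eq_bigr => i _; rewrite mulrA.
Qed.

Lemma ideal_gen_sub S J : is_ideal J -> S `<=` J -> ideal_gen S `<=` J.
Proof.
move=> idJ SJ f [n [a [g [Sg ->]]]]; apply: is_ideal_sum => // i _.
by case: idJ => _ _; apply; apply: SJ.
Qed.

Lemma sub_ideal_gen S : S `<=` ideal_gen S.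
Proof.
move=> f Sf; exists 1%N, (fun=> 1), (fun=> f); split=> //.
by rewrite big_ord1 mul1r.
Qed.

Lemma is_ideal_add I J : is_ideal I -> is_ideal J -> is_ideal (ideal_add I J).
Proof.
move=> [I0 ID IM] [J0 JD JM]; split.
- by exists 0 => //; exists 0 => //; rewrite addr0.
- move=> _ _ [f1 If1 [g1 Jg1 <-]] [f2 If2 [g2 Jg2 <-]].
  exists (f1 + f2); first exact: ID.
  by exists (g1 + g2); [exact: JD|rewrite addrACA].
- move=> h _ [f If [g Jg <-]].
  by exists (h * f); [exact: IM|exists (h * g); [exact: JM|rewrite mulrDr]].
Qed.

Lemma ideal_add_subl I J : is_ideal J -> I `<=` ideal_add I J.
Proof.
by case=> J0 _ _ f If; exists f => //; exists 0 => //; rewrite addr0.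
Qed.

Lemma ideal_add_subr I J : is_ideal I -> J `<=` ideal_add I J.
Proof.
by case=> I0 _ _ f Jf; exists 0 => //; exists f => //; rewrite add0r.
Qed.

Lemma is_ideal_exp I n : is_ideal (ideal_exp I n).
Proof. exact: is_ideal_gen. Qed.

Lemma ideal_exp0 I f : ideal_exp I 0 f.
Proof.
have [_ _ IM] := is_ideal_exp I 0.
rewrite -[f]mulr1; apply: IM; apply: sub_ideal_gen.
by exists (fun=> 0); split; [case|rewrite big_ord0].
Qed.

Lemma ideal_exp1 I : is_ideal I -> ideal_exp I 1 `<=` I.
Proof.
by move=> idI; apply: ideal_gen_sub => // _ [g [Ig ->]]; rewrite big_ord1.
Qed.

Lemma ideal_expS I n f g :
  I f -> ideal_exp I n g -> ideal_exp I n.+1 (f * g).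
Proof.
move=> If; move: g; have [E0 ED EM] := is_ideal_exp I n.+1.
apply: (@ideal_gen_sub _ [set g | ideal_exp I n.+1 (f * g)]).
  split; rewrite /= ?mulr0 //.
  - by move=> g h Eg Eh; rewrite mulrDr; apply: ED.
  - by move=> g h Eh; rewrite mulrCA; apply: EM.
move=> _ [g [Ig ->]]; apply: sub_ideal_gen.
exists (fun i => oapp g f (unlift ord0 i)); split.
  by move=> i; case: (unliftP ord0 i) => [j|] _ /=; [exact: Ig|exact: If].
rewrite big_ord_recl unlift_none /=; congr (_ * _).
by apply: eq_bigr => i _; rewrite liftK.
Qed.

Lemma ideal_exp_anti I n n' : is_ideal I -> (n <= n')%N ->
  ideal_exp I n' `<=` ideal_exp I n.
Proof.
move=> [I0 ID IM] le_nn'; rewrite -(subnK le_nn').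
apply: ideal_gen_sub; first exact: is_ideal_exp.
move=> _ [g [Ig ->]]; have [_ _ EM] := is_ideal_exp I n.
rewrite big_split_ord /=; apply: EM; apply: sub_ideal_gen.
by exists (fun i => g (rshift (n' - n) i)).
Qed.

End IdealLemmas.

Section LocalExt.
Variable A : idomainType.
Implicit Types (p J : set A).

Lemma prime_idealP p : prime_ideal p <->
  [/\ is_ideal p, ~ p 1 & forall u v, p (u * v) -> p u \/ p v].
Proof.
split=> [[[p0 p1 pD] pM]|[[p0 pD pM] p1 pP]].
  split; [split| |].
  - by move: p0; rewrite inE.
  - move=> f g /mem_set pf /mem_set pg.
    by move: (pD 1 f g pf pg); rewrite mul1r inE.
  - by move=> f g /mem_set pg; move: (pD f g 0 pg p0); rewrite addr0 inE.
  - by move=> /mem_set; apply/negP.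
  - by move=> u v /mem_set /pM /orP[] /set_mem; [left|right].
split; [split|].
- exact: mem_set.
- by apply/negP => /set_mem.
- by move=> a u v /set_mem pu /set_mem pv; apply/mem_set/pD => //; apply: pM.
- by move=> u v /set_mem /pP[] /mem_set ->; rewrite ?orbT.
Qed.

(** Clearing denominators: an element of [J A_p] is a fraction with numerator
    in [J] and denominator outside [p]. *)
Lemma local_ext_fraction p J z : prime_ideal p -> is_ideal J ->
  local_ext p J z -> exists s h, [/\ ~ p s, J h &
    z * FracField.tofrac s = FracField.tofrac h].
Proof.
move=> /prime_idealP[[p0 _ _] p1 pP] [J0 JD JM] [n [u [g [lu Jg ->]]]].
apply: (big_ind (fun z => exists s h, [/\ ~ p s, J h &
    z * FracField.tofrac s = FracField.tofrac h])).
- by exists 1, 0; rewrite mul0r tofrac0.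
- move=> x y [s [h [ps Jh xs]]] [t [l [pt Jl yt]]].
  exists (s * t), (t * h + s * l); split.
  + by move=> /pP[].
  + by apply: JD; apply: JM.
  + by rewrite tofracD !tofracM -xs -yt; ring.
- move=> i _; have [a _ [s ps <-]] := lu i.
  exists s, (a * g i); split=> //; first exact: JM.
  rewrite tofracM mulrAC divfK // tofrac_eq0.
  by apply/negP => /eqP s0; apply: ps; rewrite s0.
Qed.

End LocalExt.

(** * Superadditive functions of the exponents *)

Section MonomialOrders.
Variables (k : idomainType) (n : nat).
Implicit Types (f g s : mpoly n k) (a b : multinom n) (phi : multinom n -> nat).

(** The polynomials all of whose monomials [a] satisfy [d <= phi a]. For
    additive [phi] these are the polynomials of valuation at least [d]. *)
Definition ordge phi (d : nat) : set (mpoly n k : idomainType) :=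
  [set f : mpoly n k | forall a, a \in msupp f -> (d <= phi a)%N].

Lemma is_ideal_monomial f (I : set (mpoly n k : idomainType)) :
  is_ideal I -> (forall a, a \in msupp f -> I (mpolyX k a)) -> I f.
Proof.
move=> idI If; rewrite [f]mpolyE big_seq; apply: is_ideal_sum => // a fa.
by rewrite -mul_mpolyC; case: idI => _ _; apply; apply: If.
Qed.

(** A property of monomials that is inherited by multiples defines an ideal. *)
Lemma is_ideal_supported (Q : multinom n -> Prop) :
  (forall a b, Q b -> Q (mnm_add a b)) ->
  is_ideal [set f : (mpoly n k : idomainType) |
               forall a : multinom n, a \in msupp f -> Q a].
Proof.
move=> QD; split.
- by move=> a; rewrite msupp0.
- move=> f g Qf Qg a /msuppD_le; rewrite mem_cat => /orP[].
    exact: Qf.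
  exact: Qg.
- by move=> f g Qg _ /msuppM_le /allpairsP[[a b] /= [fa gb ->]]; apply/QD/Qg.
Qed.

Lemma ordgeM phi d e f g :
  (forall a b, phi a + phi b <= phi (mnm_add a b))%N ->
  ordge phi d f -> ordge phi e g -> ordge phi (d + e) (f * g).
Proof.
move=> phiD df dg _ /msuppM_le /allpairsP[[a b] /= [fa gb ->]].
by apply: leq_trans (phiD a b); rewrite leq_add ?df ?dg.
Qed.

Lemma is_ideal_ordge phi d :
  (forall a b, phi a + phi b <= phi (mnm_add a b))%N -> is_ideal (ordge phi d).
Proof.
move=> phiD; apply: is_ideal_supported => a b db.
by apply: leq_trans (phiD a b); rewrite (leq_trans db) ?leq_addl.
Qed.

Lemma ordge_exp phi (I : set (mpoly n k : idomainType)) r :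
  (forall a b, phi a + phi b <= phi (mnm_add a b))%N ->
  I `<=` ordge phi 1 -> ideal_exp I r `<=` ordge phi r.
Proof.
move=> phiD I1; apply: ideal_gen_sub; first exact: is_ideal_ordge.
move=> _ [g [Ig ->]]; elim: r g Ig => [|r IHr] g Ig; first by move=> a.
rewrite big_ord_recl; apply: (@ordgeM phi 1 r) => //; first exact/I1.
exact: IHr.
Qed.

(** The part of [f] supported by the monomials satisfying [P]. *)
Definition mpart (P : pred (multinom n)) f : mpoly n k :=
  \sum_(a <- msupp f | P a) mcoeff a f *: mpolyX k a.

Lemma mcoeff_mpart P f b : mcoeff b (mpart P f) = if P b then mcoeff b f else 0.
Proof.
rewrite /mpart raddf_sum /= big_mkcond /=.
under eq_bigr do rewrite mcoeffZ mcoeffX.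
have [fb|/[dup] Nfb /memN_msupp_eq0 ->] := boolP (b \in msupp f).
  rewrite (bigD1_seq b) ?msupp_uniq //= eqxx mulr1 big1 ?addr0 // => c cb.
  by rewrite (negbTE cb) mulr0 if_same.
rewrite if_same big_seq big1 // => c fc.
have [cb|] := eqVneq c b; last by rewrite mulr0 if_same.
by rewrite -cb fc in Nfb.
Qed.

Lemma msupp_mpart P f b : (b \in msupp (mpart P f)) = P b && (b \in msupp f).
Proof. by rewrite !mcoeff_msupp mcoeff_mpart; case: (P b); rewrite ?eqxx. Qed.

Lemma mpartD P f : f = mpart P f + mpart (predC P) f.
Proof.
apply/mpolyP => b; rewrite mcoeffD !mcoeff_mpart /=.
by case: (P b); rewrite ?addr0 ?add0r.
Qed.

(** The valuation of a product is at most that of [f] when [s] has valuation 0: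
    the product of the initial forms of [f] and [s] is nonzero, and nothing else
    in [f * s] has the same weight. *)
Lemma ordge_divr phi d f s :
  (forall a b, phi (mnm_add a b) = phi a + phi b)%N ->
  ~ ordge phi 1 s -> ordge phi d (f * s) -> ordge phi d f.
Proof.
move=> phiD s0 dfs; apply: contrapT => Ndf.
have [a [fa lt_ad]] : exists a, a \in msupp f /\ (phi a < d)%N.
  apply: contrapT => Ha; apply: Ndf => a fa; rewrite leqNgt; apply/negP => ltad.
  by apply: Ha; exists a.
have exw : exists w, has (fun a => phi a == w) (msupp f).
  by exists (phi a); apply/hasP; exists a.
case: (ex_minnP exw) => w /hasP[a0 fa0 /eqP wa0] minw.
have lt_wd : (w < d)%N.
  by apply: leq_ltn_trans lt_ad; apply: minw; apply/hasP; exists a.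
have {s0} [b [sb b0]] : exists b, b \in msupp s /\ phi b = 0%N.
  apply: contrapT => Hb; apply: s0 => b sb; rewrite lt0n; apply/eqP => b0.
  by apply: Hb; exists b.
(* w is the least weight of a monomial of f; f0 and s0 are the initial forms of
   f and s, and f1 and s1 what remains. *)
pose f0 := mpart (fun c => phi c == w) f.
pose f1 := mpart (predC (fun c => phi c == w)) f.
pose s0 := mpart (fun c => phi c == 0%N) s.
pose s1 := mpart (predC (fun c => phi c == 0%N)) s.
have f0N0 : f0 != 0.
  apply: contraTneq (fa0) => f00.
  have : a0 \notin msupp f0 by rewrite f00 msupp0.
  by rewrite msupp_mpart wa0 eqxx.
have s0N0 : s0 != 0.
  apply: contraTneq (sb) => s00.
  have : b \notin msupp s0 by rewrite s00 msupp0.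
  by rewrite msupp_mpart b0 eqxx.
have phiD' a1 a2 : (phi a1 + phi a2 <= phi (mnm_add a1 a2))%N by rewrite phiD.
have hi : ordge phi w.+1 (f0 * s1 + f1 * s).
  have [_ ordgeD _] := is_ideal_ordge w.+1 phiD'; apply: ordgeD.
    rewrite -addn1; apply: ordgeM => // c.
      by rewrite msupp_mpart => /andP[/eqP ->].
    by rewrite msupp_mpart /= -lt0n => /andP[].
  rewrite -[w.+1]addn0; apply: ordgeM => // c.
  rewrite msupp_mpart /= => /andP[cw fc]; rewrite ltn_neqAle eq_sym cw /=.
  by apply: minw; apply/hasP; exists c.
have fsE : f * s = f0 * s0 + (f0 * s1 + f1 * s).
  rewrite addrA -mulrDr -mpartD -mulrDl; congr (_ * _); exact: mpartD.
have : msupp (f0 * s0) != [::] by rewrite msupp_eq0 mulf_eq0 negb_or f0N0.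
case E : (msupp (f0 * s0)) => [//|c t] _.
have fsc : c \in msupp (f0 * s0) by rewrite E inE eqxx.
have cw : phi c = w.
  have /allpairsP[[c1 c2] /= [+ + ->]] := msuppM_le fsc.
  rewrite !msupp_mpart => /andP[/eqP c1w _] /andP[/eqP c20 _].
  by rewrite phiD c1w c20 addn0.
have : c \in msupp (f * s).
  rewrite mcoeff_msupp fsE mcoeffD [X in _ + X]memN_msupp_eq0.
    by rewrite addr0 -mcoeff_msupp.
  by apply/negP => /hi; rewrite cw ltnn.
by move=> /dfs; rewrite cw leqNgt lt_wd.
Qed.

End MonomialOrders.

(** * Monomials and the ideal of the three blocks *)

Section BlockIdeal.
Variables (k : fieldType) (m : nat).
Local Notation N := (2 * m - 1)%N.
Local Notation mon := (multinom (3 * N)).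
Local Notation P := (Pm k m).
Implicit Types (a b : mon) (j : 'I_3) (T : {set 'I_N}) (S : 'I_3 -> {set 'I_N}).

(** The monomial with exponent [e j i] at the variable [i] of block [j]; the
    variables of the three blocks are numbered as the entries of a matrix. *)
Definition block_mon (e : 'I_3 -> 'I_N -> nat) : mon :=
  Multinom [tuple mxvec (\matrix_(j < 3, i < N) e j i) 0 l | l < 3 * N].

Lemma block_monE e j i : block_mon e (mxvec_index j i) = e j i.
Proof. by rewrite /block_mon mnmE mxvecE mxE. Qed.

Lemma mon_eqP a b :
  (forall j i, a (mxvec_index j i) = b (mxvec_index j i)) -> a = b.
Proof. by move=> ab; apply/mnmP => l; case/mxvec_indexP: l => j i. Qed.

(** The variables of block [j] that divide the monomial [a]. *)
Definition supp a (j : 'I_3) : {set 'I_N} :=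
  finset (fun i => 0 < a (mxvec_index j i))%N.

(** The product of the variables of block [j] indexed by [T]. *)
Definition set_mon (j : 'I_3) (T : {set 'I_N}) : mon :=
  block_mon (fun j' i => (j' == j) && (i \in T)).

Lemma prod_varE j T : \prod_(i in T) var k m j i = mpolyX k (set_mon j T).
Proof.
rewrite /var (mprodXE k); congr (mpolyX k _); apply: mon_eqP => j' i.
rewrite mnm_sumE block_monE.
have E i' : mnm1 (mxvec_index j i') (mxvec_index j' i) =
            ((j == j') && (i' == i)) :> nat.
  rewrite mnm1E /mxvec_index (inj_eq (@cast_ord_inj _ _ _)).
  by rewrite (inj_eq enum_rank_inj) xpair_eqE.
under eq_bigr do rewrite E.
have [_|_] := eqVneq j' j; last by rewrite big1.
rewrite /= big_mkcond (bigD1 i) //= eqxx big1 ?addn0; first by case: (i \in T).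
by move=> i' /negbTE ->; rewrite if_same.
Qed.

Lemma set_mon_lem j T a : T \subset supp a j -> lem (set_mon j T) a.
Proof.
move=> /fintype.subsetP Ta; apply/mnm_lepP => l; case/mxvec_indexP: l => j' i.
rewrite block_monE; case: eqVneq => [->|] //=.
by case: (boolP (i \in T)) => // /Ta; rewrite inE.
Qed.

Lemma is_ideal_Iblock j : is_ideal (Iblock k m j).
Proof. exact: is_ideal_gen. Qed.

Lemma is_ideal_Pm : is_ideal P.
Proof. by do !apply: is_ideal_add; apply: is_ideal_Iblock. Qed.

Lemma Iblock_sub_Pm j : Iblock k m j `<=` P.
Proof.
move=> f If; have : [|| j == inord 0, j == inord 1 | j == inord 2].
  by rewrite -!val_eqE /= !inordK //; case: j {If} => -[|[|[|]]].
have idI := is_ideal_Iblock.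
case/or3P => /eqP jE; rewrite jE in If.
- by do 2 (apply: ideal_add_subl => //).
- by apply: ideal_add_subl => //; apply: ideal_add_subr.
- by apply: ideal_add_subr => //; apply: is_ideal_add.
Qed.

Lemma Pm_set_mon j T : #|T| = m -> P (mpolyX k (set_mon j T)).
Proof.
move=> Tm; apply: (@Iblock_sub_Pm j); apply: sub_ideal_gen.
by exists T; split=> //; rewrite prod_varE.
Qed.

Lemma Pm_supp (f : polyR k m) a : P f -> a \in msupp f ->
  exists j T, #|T| = m /\ T \subset supp a j.
Proof.
pose Q b := exists j T, #|T| = m /\ T \subset supp b j.
have idQ : is_ideal [set f : (mpoly (3 * N) k : idomainType) |
    forall b : mon, b \in msupp f -> Q b].
  apply: is_ideal_supported => b c [j [T [Tm Tc]]]; exists j, T; split=> //.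
  apply: fintype.subset_trans Tc _; apply/fintype.subsetP => i.
  by rewrite !inE mnmDE; lia.
have IQ j : Iblock k m j `<=` [set f : (mpoly (3 * N) k : idomainType) |
    forall b : mon, b \in msupp f -> Q b].
  apply: ideal_gen_sub => // _ [T [Tm ->]] b; rewrite prod_varE.
  move=> /mem_msuppXP <-; exists j, T; split=> //.
  by apply/fintype.subsetP => i iT; rewrite inE block_monE eqxx iT.
case: (idQ) => _ QD _ [g [g0 I0 [g1 I1 <-]] [g2 I2 <-]]; move: a.
by apply: (QD _ _ _ (IQ _ _ I2)); apply: QD; apply: IQ; eassumption.
Qed.

Lemma ideal_exp_PmS r a j T : #|T| = m -> T \subset supp a j ->
  ideal_exp P r (mpolyX k (mnm_sub a (set_mon j T))) ->
  ideal_exp P r.+1 (mpolyX k a).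
Proof.
move=> Tm Ta Pa.
rewrite -[a in mpolyX k a](submK (set_mon_lem Ta)) mpolyXD mulrC.
by apply: ideal_expS => //; apply: Pm_set_mon.
Qed.

End BlockIdeal.

(** * Associated primes and symbolic powers *)

Section SymbolicPowers.
Variables (k : fieldType) (m : nat).
Hypothesis m_gt0 : (0 < m)%N.
Local Notation N := (2 * m - 1)%N.
Local Notation mon := (multinom (3 * N)).
Local Notation P := (Pm k m).
Implicit Types (a b : mon) (j : 'I_3) (T : {set 'I_N}) (S : 'I_3 -> {set 'I_N}).

(** The degree in the variables of [S j], for all blocks [j]. The set
    [ordge (weight S) 1] is the ideal [p_S] generated by these variables. *)
Definition weight S a : nat :=
  (\sum_j \sum_(i in S j) a (mxvec_index j i))%N.

(** A choice [S] of [m] variables in every block. *)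
Definition msel S : Prop := forall j, #|S j| = m.

(** The power [n] of the product of the variables outside [S]. *)
Definition compl_mon S (n : nat) : mon :=
  block_mon (fun j i => (i \notin S j) * n)%N.

Lemma weightD S a b : weight S (mnm_add a b) = (weight S a + weight S b)%N.
Proof.
rewrite /weight -big_split /=; apply: eq_bigr => j _; rewrite -big_split /=.
by apply: eq_bigr => i _; rewrite mnmDE.
Qed.

Lemma weight_compl_mon S n : weight S (compl_mon S n) = 0%N.
Proof.
rewrite /weight big1 // => j _; rewrite big1 // => i iS.
by rewrite block_monE iS.
Qed.

Lemma weight_set_mon S j T : weight S (set_mon j T) = #|S j :&: T|.
Proof.
rewrite /weight (bigD1 j) //= [X in (_ + X)%N]big1 ?addn0.
  rewrite -sum1_card big_mkcond [RHS]big_mkcond; apply: eq_bigr => i _.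
  by rewrite block_monE eqxx inE; case: (i \in S j).
by move=> j' /negbTE jj'; rewrite big1 // => i _; rewrite block_monE jj'.
Qed.

Lemma Pm_sub_ordge S : msel S -> P `<=` @ordge k _ (weight S) 1.
Proof.
move=> Sm f Pf a fa; have [j [T [Tm Ta]]] := Pm_supp Pf fa.
rewrite -(submK (set_mon_lem Ta)) weightD weight_set_mon.
rewrite addn_gt0; apply/orP; right.
(* Two m-subsets of a block meet, the block having fewer than 2m elements. *)
have : (#|S j :|: T| <= N)%N by rewrite -[leqRHS]card_ord max_card.
by have := cardsUI (S j) T; rewrite (Sm j) Tm; move: m_gt0; lia.
Qed.

Lemma weight_superD S a b :
  (weight S a + weight S b <= weight S (mnm_add a b))%N.
Proof. by rewrite weightD. Qed.

Lemma Pm_exp_sub_ordge S n :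
  msel S -> ideal_exp P n `<=` @ordge k _ (weight S) n.
Proof.
by move=> Sm; apply: ordge_exp (weight_superD S) _; apply: Pm_sub_ordge.
Qed.

(** After localization at [p_S], the ideals [P] and [p_S] have the same powers:
    up to the variables outside [S], weight [n] suffices to be in [P ^ n]. *)
Lemma ideal_exp_Pm_weight S n b : msel S -> (n <= weight S b)%N ->
  (forall j i, i \notin S j -> (n <= b (mxvec_index j i))%N) ->
  ideal_exp P n (mpolyX k b).
Proof.
move=> Sm; elim: n b => [|n IHn] b wb Sb; first exact: ideal_exp0.
have [j [i [iS bi]]] : exists j i, i \in S j /\ (0 < b (mxvec_index j i))%N.
  apply: contrapT => H; move: wb; rewrite /weight big1 // => j _.
  rewrite big1 // => i iS; apply/eqP; rewrite -leqn0 leqNgt; apply/negP => bi.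
  by apply: H; exists j, i.
(* The generator split off is the product of the variable i with the m - 1
   variables of its block outside S. *)
pose T := i |: ~: S j.
have Tm : #|T| = m.
  rewrite cardsU1 cardsCs finset.setCK card_ord (Sm j) !inE iS /=; lia.
have Tb : T \subset supp b j.
  apply/fintype.subsetP => i'; rewrite !inE => /orP[/eqP -> //|/Sb].
  exact: leq_trans.
have STi : S j :&: T = [set i]%SET.
  apply/setP => i'; rewrite !inE andb_orr andbN orbF.
  by case: eqVneq => [->|]; rewrite ?iS ?andbF.
apply: (ideal_exp_PmS Tm Tb); apply: IHn.
  have := weightD S (mnm_sub b (set_mon j T)) (set_mon j T).
  rewrite submK ?set_mon_lem // weight_set_mon STi cards1 => wbE.
  by move: wb; rewrite wbE; lia.
move=> j' i' /Sb; rewrite mnmBE.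
have : (set_mon j T (mxvec_index j' i') <= 1)%N.
  by rewrite block_monE leq_b1.
lia.
Qed.

Lemma ideal_exp_Pm_compl S n a : msel S -> (n <= weight S a)%N ->
  ideal_exp P n (mpolyX k (mnm_add a (compl_mon S n))).
Proof.
move=> Sm wa; apply: (ideal_exp_Pm_weight Sm) => //.
  by rewrite weightD weight_compl_mon addn0.
by move=> j i iS; rewrite mnmDE block_monE iS mul1n leq_addl.
Qed.

Lemma ordge_compl_mon S n (f : polyR k m) :
  msel S -> @ordge k _ (weight S) n f ->
  ideal_exp P n (f * (mpolyX k (compl_mon S n) : polyR k m)).
Proof.
move=> Sm wf; have [E0 ED EM] := is_ideal_exp P n.
pose s : polyR k m := mpolyX k (compl_mon S n).
pose J : set (polyR k m) := [set f | ideal_exp P n (f * s)].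
suff : J f by [].
apply: is_ideal_monomial.
  split; rewrite /J /= ?mul0r //.
  - by move=> g h Eg Eh; rewrite mulrDl; apply: ED.
  - by move=> g h Eh; rewrite -mulrA; apply: EM.
move=> a /wf wa; have := ideal_exp_Pm_compl Sm wa.
by rewrite mpolyXD.
Qed.

Lemma compl_mon_nordge S n :
  ~ @ordge k _ (weight S) 1 (mpolyX k (compl_mon S n)).
Proof.
move=> /(_ (compl_mon S n)); rewrite weight_compl_mon; apply/not_implyP.
by split=> //; apply/mem_msuppXP.
Qed.

Lemma prime_ordge S : prime_ideal (@ordge k _ (weight S) 1).
Proof.
apply/prime_idealP; split.
- exact/is_ideal_ordge/weight_superD.
- have <- : mpolyX k (compl_mon S 0) = 1.
    rewrite -mpolyX0; congr (mpolyX k _); apply: mon_eqP => j i.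
    by rewrite block_monE muln0 mnm0E.
  exact: compl_mon_nordge.
- move=> u v uv.
  have [|Nv] := pselect (@ordge k _ (weight S) 1 v); first by right.
  by left; apply: ordge_divr Nv uv; apply: weightD.
Qed.

Lemma Ass_ordge S : msel S -> Ass P (@ordge k _ (weight S) 1).
Proof.
move=> Sm; split; first exact: prime_ordge.
exists (mpolyX k (compl_mon S 1)); apply/seteqP; split => f /=.
  move=> wf; apply: ideal_exp1; first exact: is_ideal_Pm.
  exact: ordge_compl_mon.
move=> /(Pm_sub_ordge Sm); apply: ordge_divr; first exact: weightD.
exact: compl_mon_nordge.
Qed.

Lemma Ass_sub p : Ass P p -> exists S, msel S /\ p `<=` @ordge k _ (weight S) 1.
Proof.
move=> [/prime_idealP[_ p1 _] [x px]].
have Px : ~ P x by move=> Px; apply: p1; rewrite px /= mul1r.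
(* As x is not in P, it has a monomial a that is divisible by fewer than m
   variables of each block; S avoids these variables, and x is not in p_S. *)
have [a [xa Na]] : exists a, a \in msupp x /\ ~ exists j, (m <= #|supp a j|)%N.
  apply: contrapT => H; apply: Px; apply: is_ideal_monomial => [|a xa].
    exact: is_ideal_Pm.
  apply: contrapT => Pa; apply: H; exists a; split=> // -[j mj].
  have [|T [_ Ta Tm]] :=
      @subset_between _ finset.set0 (supp a j) m (finset.sub0set _).
    by rewrite cards0.
  apply: Pa; apply: ideal_exp1; first exact: is_ideal_Pm.
  exact: (ideal_exp_PmS Tm Ta) (ideal_exp0 _ _).
have /choice[S HS] : forall j, exists T, #|T| = m /\ T \subset ~: supp a j.
  move=> j; have [|T [_ Ta Tm]] :=
      @subset_between _ finset.set0 (~: supp a j) m (finset.sub0set _).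
    rewrite cards0 cardsCs finset.setCK card_ord.
    have : ~~ (m <= #|supp a j|)%N by apply/negP => mj; apply: Na; exists j.
    by lia.
  by exists T.
have Sm : msel S by move=> j; case: (HS j).
exists S; split=> // f; rewrite px => /(Pm_sub_ordge Sm).
apply: ordge_divr; first exact: weightD.
move=> /(_ a xa); rewrite /weight big1 // => j _; rewrite big1 // => i iS.
have [_ /fintype.subsetP/(_ i iS)] := HS j.
by rewrite !inE -leqNgt leqn0 => /eqP.
Qed.

(** [P^(n)] is the intersection of the powers [p_S ^ n]. *)
Lemma symbolic_power_PmP n (f : polyR k m) :
  symbolic_power P n f <-> forall S, msel S -> @ordge k _ (weight S) n f.
Proof.
split=> [symf S Sm|wf p Assp].
  have [s [h [ps Ph fsh]]] := local_ext_fraction (prime_ordge S)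
    (is_ideal_exp P n) (symf _ (Ass_ordge Sm)).
  apply: (@ordge_divr _ _ _ _ _ s) => //; first exact: weightD.
  move: fsh; rewrite -tofracM => /eqP; rewrite tofrac_eq => /eqP ->.
  exact: (Pm_exp_sub_ordge Sm).
(* The denominator s is a monomial in variables outside p_S, hence outside p. *)
have [S [Sm pS]] := Ass_sub Assp.
pose s : polyR k m := mpolyX k (compl_mon S n).
have ps : ~ p s by move=> /pS; apply: compl_mon_nordge.
exists 1%N, (fun=> (FracField.tofrac 1 / FracField.tofrac s)), (fun=> f * s).
split.
- by move=> _; exists 1 => //; exists s.
- by move=> _; apply: ordge_compl_mon => //; apply: wf.
- have s0 : s != 0.
    apply: contra_notN ps => /eqP ->.
    by have [/prime_idealP[[]]] := Assp.
  by rewrite big_ord1 tofrac1 tofracM mul1r mulrCA mulVf ?mulr1 // tofrac_eq0.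
Qed.

End SymbolicPowers.

(** * Containments between symbolic and ordinary powers *)

Section Containments.
Variables (k : fieldType) (m : nat).
Hypothesis m_gt0 : (0 < m)%N.
Local Notation N := (2 * m - 1)%N.
Local Notation mon := (multinom (3 * N)).
Local Notation P := (Pm k m).
Implicit Types (a b : mon) (j : 'I_3) (T : {set 'I_N}) (S : 'I_3 -> {set 'I_N}).

Lemma ideal_exp_Pm_mon (r : 'I_3 -> nat) a :
  (forall j, r j * m <= \sum_i minn (a (mxvec_index j i)) (r j))%N ->
  ideal_exp P (\sum_j r j)%N (mpolyX k a).
Proof.
move En : (\sum_j r j)%N => n; elim: n => [|n IHn] in r a En * => ra.
  exact: ideal_exp0.
have [j rj] : exists j, (0 < r j)%N.
  apply: contrapT => H; move: En; rewrite big1 // => j _.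
  by apply/eqP; rewrite -leqn0 leqNgt; apply/negP => rj; apply: H; exists j.
have := ra j; rewrite -(prednK rj) => /peel_subset[T [Tm Ta Tr]].
have Ts : T \subset supp a j by apply/fintype.subsetP => i /Ta; rewrite inE.
apply: (ideal_exp_PmS Tm Ts).
apply: (IHn (fun j' => r j' - (j' == j))%N).
  apply/eqP; rewrite -(eqn_add2r 1) [in eqbRHS]addn1 -En eq_sym.
  rewrite (bigD1 j) //= [in eqbRHS](bigD1 j) //= eqxx addnAC subnK //.
  rewrite eqn_add2l; apply/eqP; apply: eq_bigr => j' /negbTE ->.
  by rewrite subn0.
move=> j'; have [->|jj'] := eqVneq j' j.
  rewrite (subn1 (r j)); apply: leq_trans Tr _; apply: leq_sum => i _.
  by rewrite mnmBE block_monE eqxx.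
rewrite subn0; apply: leq_trans (ra j') _; apply: leq_sum => i _.
by rewrite mnmBE block_monE (negbTE jj') subn0.
Qed.

Lemma symbolic_power_sub_exp n r : ((r + 3) * m ^ 2 <= n * (2 * m - 1))%N ->
  symbolic_power P n `<=` ideal_exp P r.
Proof.
move=> nr f /(symbolic_power_PmP m_gt0) wf.
apply: is_ideal_monomial => [|a fa]; first exact: is_ideal_exp.
have /choice[S HS] : forall j, exists T, #|T| = m /\ forall r,
   (r * m ^ 2 <= (2 * m - 1) * \sum_(i in T) a (mxvec_index j i))%N ->
   (r * m <= \sum_i minn (a (mxvec_index j i)) r)%N.
  by move=> j; apply: min_subset => //; rewrite card_ord.
have Sm : msel S by move=> j; case: (HS j).
pose s j := (\sum_(i in S j) a (mxvec_index j i))%N.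
(* q j generators of block j can be split off; the three integer parts lose less
   than 3 in total. *)
pose q j := ((2 * m - 1) * s j %/ m ^ 2)%N.
have nw : (n <= \sum_j s j)%N by apply: wf fa.
have m2 : (0 < m ^ 2)%N by rewrite expn_gt0 m_gt0.
have rq : (r <= \sum_j q j)%N.
  rewrite -(leq_add2r 3) -(leq_pmul2r m2); apply: leq_trans nr _.
  apply: leq_trans (_ : _ <= (\sum_j s j) * (2 * m - 1))%N _.
    by rewrite leq_mul2r nw orbT.
  have -> : (\sum_j q j + 3 = \sum_j (q j + 1))%N.
    by rewrite big_split /= sum_nat_const card_ord.
  rewrite !big_distrl /=; apply: leq_sum => j _.
  by rewrite mulnC addn1 ltnW // ltn_ceil.
apply: (ideal_exp_anti (is_ideal_Pm _ _) rq).
apply: ideal_exp_Pm_mon => j; have [_] := HS j; apply.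
exact: leq_trunc_div.
Qed.

(** An upper bound for the number of generators of [P] whose product divides
    [a], obtained by counting degrees in each block. *)
Definition degfloor a : nat := (\sum_j (\sum_i a (mxvec_index j i)) %/ m)%N.

Lemma degfloorD a b : (degfloor a + degfloor b <= degfloor (mnm_add a b))%N.
Proof.
rewrite /degfloor -big_split /=; apply: leq_sum => j _.
rewrite leq_divRL // mulnDl.
under [leqRHS]eq_bigr do rewrite mnmDE.
by rewrite big_split /= leq_add ?leq_trunc_div.
Qed.

Lemma Pm_exp_degfloor r : ideal_exp P r `<=` @ordge k _ degfloor r.
Proof.
apply: ordge_exp degfloorD _ => f Pf a fa.
have [j [T [Tm Ta]]] := Pm_supp Pf fa.
rewrite /degfloor (bigD1 j) //= addn_gt0 divn_gt0 //; apply/orP; left.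
rewrite -[leqLHS]Tm -sum1_card big_mkcond /=; apply: leq_sum => i _.
by case: ifP => // /(fintype.subsetP Ta); rewrite inE.
Qed.

(** The obstruction is the product over all blocks [j] of the power [c j] of the
    product of the variables of block [j]. *)
Lemma symbolic_power_Nsub_exp (c : 'I_3 -> nat) n r :
  (n <= m * \sum_j c j)%N -> (\sum_j ((2 * m - 1) * c j) %/ m < r)%N ->
  ~ symbolic_power P n `<=` ideal_exp P r.
Proof.
move=> nc cr; pose a : mon := block_mon (fun j _ => c j).
move=> /(_ (mpolyX k a)) H.
have /H /Pm_exp_degfloor : symbolic_power P n (mpolyX k a).
  apply/symbolic_power_PmP => // S Sm _ /mem_msuppXP <-.
  apply: leq_trans nc _; rewrite big_distrr /=; apply: leq_sum => j _.
  rewrite -[X in (X * _ <= _)%N](Sm j) -sum_nat_const; apply: leq_sum => i _.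
  by rewrite block_monE.
move=> /(_ a); rewrite leqNgt /degfloor; move/(_ _)/negP; apply.
  exact/mem_msuppXP.
apply: leq_ltn_trans cr; apply: leq_sum => j _; apply: leq_div2r.
by under eq_bigr do rewrite block_monE; rewrite sum_nat_const card_ord.
Qed.

End Containments.

(** * Resurgence and asymptotic resurgence *)

Section Resurgence.
Variables (R : realType) (k : fieldType) (m : nat).
Hypothesis m_ge2 : (2 <= m)%N.
Local Notation P := (Pm k m).

Lemma resurgence_ge : (((3 * m%:R / 4)%R)%:E <= resurgence R P)%E.
Proof.
have m_gt0 : (0 < m)%N by apply: leq_trans m_ge2.
(* The product of all variables is in P^(3m) but not in P^4. *)
apply: ereal_sup_ubound; exists (3 * m)%N, 4%N; split=> //; first lia.
- apply: (@symbolic_power_Nsub_exp k m m_gt0 (fun=> 1%N)).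
    by rewrite sum_nat_const card_ord; lia.
  rewrite sum_nat_const card_ord muln1.
  by rewrite (_ : (2 * m - 1) %/ m = 1)%N //; apply/eqP; rewrite eqn_leq -ltnS
    ltn_divLR // divn_gt0 //; lia.
- by rewrite natrM.
Qed.

Lemma near_symbolic_power_sub_exp (p r : nat) :
  (m ^ 2 * r < p * (2 * m - 1))%N ->
  \forall t \near \oo, symbolic_power P (p * t) `<=` ideal_exp P (r * t).
Proof.
move=> pr; exists (3 * m ^ 2)%N => // t /= tm.
apply: symbolic_power_sub_exp; first exact: leq_trans m_ge2.
by nia.
Qed.

Lemma near_symbolic_power_Nsub_exp (p r : nat) :
  (p * (2 * m - 1) < m ^ 2 * r)%N ->
  \forall t \near \oo, ~ symbolic_power P (p * t) `<=` ideal_exp P (r * t).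
Proof.
move=> pr; exists (2 * m ^ 2)%N => // t /= tm.
have m_gt0 : (0 < m)%N by apply: leq_trans m_ge2.
(* The power q of the product of one block is in P^(pt), since p t <= m q. *)
pose q := (p * t %/ m).+1.
have qm : (p * t <= m * q)%N by rewrite [leqRHS]mulnC /q ltnW // ltn_ceil.
have qm' : (q * m <= p * t + m)%N by rewrite /q mulSnr leq_add2r leq_trunc_div.
apply: (@symbolic_power_Nsub_exp k m m_gt0 (fun j => (j == ord0) * q)%N).
  by rewrite !big_ord_recl big_ord0 /= mul1n !addn0.
rewrite !big_ord_recl big_ord0 /= mul1n !mul0n !muln0 !div0n !addn0.
rewrite ltn_divLR // -(ltn_pmul2r m_gt0).
have h : ((2 * m - 1) * (q * m) <= (2 * m - 1) * (p * t + m))%N.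
  by rewrite leq_mul2l qm' orbT.
have h2 : ((p * (2 * m - 1)).+1 * t <= m ^ 2 * r * t)%N.
  by rewrite leq_mul2r pr orbT.
by nia.
Qed.

Lemma asymptotic_resurgenceE :
  asymptotic_resurgence R P = ((m%:R ^+ 2 / (2 * m%:R - 1))%R)%:E.
Proof.
have D_gt0 : (0 : R) < 2 * m%:R - 1.
  by have : (2 : R) <= m%:R by [rewrite ler_nat]; lra.
have DE : ((2 * m - 1)%N%:R : R) = 2 * m%:R - 1.
  by rewrite natrB ?natrM //; lia.
apply/eqP; rewrite eq_le; apply/andP; split.
  apply: ge_ereal_sup => _ [p [r [p_gt0 r_gt0 Npr ->]]].
  rewrite lee_fin ler_pdivrMr ?ltr0n // mulrAC ler_pdivlMr // -DE.
  rewrite -natrX -!natrM ler_nat leqNgt.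
  apply/negP => /near_symbolic_power_sub_exp pr.
  have : \forall t \near \oo, False.
    by near=> t; have : ~ symbolic_power P (p * t) `<=` ideal_exp P (r * t);
      [near: t|apply; near: t].
  by case=> n _ /(_ n); apply => /=.
apply/lee_addgt0Pr => e e_gt0.
(* The ratio (m^2 l - 1) / ((2m - 1) l) is less than m^2 / (2m - 1), by at most
   1 / l. *)
pose l := (Num.truncn (e^-1)).+1.
pose x : R := (m ^ 2 * l - 1)%N%:R / ((2 * m - 1) * l)%N%:R.
have le_l : e^-1 < l%:R by rewrite truncnS_gt.
have m2l : (1 < m ^ 2 * l)%N.
  by rewrite (leq_trans (n := 4)) //; nia.
have ub : (x%:E <= asymptotic_resurgence R P)%E.
  apply: ereal_sup_ubound.
  exists (m ^ 2 * l - 1)%N, ((2 * m - 1) * l)%N; split=> //.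
  - by lia.
  - by rewrite muln_gt0 andbT; lia.
  - by apply: near_symbolic_power_Nsub_exp; nia.
apply: (@le_trans _ _ (x%:E + e%:E)%E); last exact: leeD2r.
rewrite -EFinD lee_fin /x natrB ?(ltnW m2l) // !natrM -?expr2 DE.
have l_gt0 : (0 : R) < l%:R by rewrite ltr0n.
have -> : (m%:R ^+ 2 * l%:R - 1) / ((2 * m%:R - 1) * l%:R) =
   m%:R ^+ 2 / (2 * m%:R - 1) - ((2 * m%:R - 1) * l%:R)^-1 :> R.
  by field; rewrite !gt_eqF.
rewrite -addrA lerDl addrC subr_ge0 invfM.
have : l%:R^-1 <= e by rewrite invf_ple ?posrE // ltW.
apply: le_trans; rewrite ler_piMl ?invr_ge0 ?(ltW l_gt0) // invf_le1 //.
by have : (2 : R) <= m%:R by [rewrite ler_nat]; lra.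
Unshelve. all: by end_near. Qed.

End Resurgence.

Unset Implicit Arguments.

Local Open Scope ereal_scope.

Theorem theorem1p4 (R : realType) (k : fieldType) :
  (forall m : nat, (2 <= m)%N ->
     [/\ ((3 * m%:R / 4)%R)%:E <= resurgence R (Pm k m),
         asymptotic_resurgence R (Pm k m)
           = ((m%:R ^+ 2 / (2 * m%:R - 1))%R)%:E
       & (((2 * m%:R ^+ 2 - 3 * m%:R) / (4 * (2 * m%:R - 1)))%R)%:E
           <= resurgence R (Pm k m) - asymptotic_resurgence R (Pm k m)]) /\
  (fun m : nat => resurgence R (Pm k m) - asymptotic_resurgence R (Pm k m))
    @ \oo --> +oo.
Proof.
have gap m : (2 <= m)%N ->
    (((2 * m%:R ^+ 2 - 3 * m%:R) / (4 * (2 * m%:R - 1)))%R)%:E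
      <= resurgence R (Pm k m) - asymptotic_resurgence R (Pm k m).
  move=> m2; rewrite asymptotic_resurgenceE //.
  apply: (@le_trans _ _ (((3 * m%:R / 4)%R)%:E -
      ((m%:R ^+ 2 / (2 * m%:R - 1))%R)%:E)).
    have D0 : ((0 : R) < 2 * m%:R - 1)%R.
      by have : ((2 : R) <= m%:R)%R by [rewrite ler_nat]; lra.
    rewrite -EFinB lee_fin le_eqVlt; apply/orP; left; apply/eqP.
    by field; rewrite gt_eqF.
  by apply: leeD2r; apply: resurgence_ge.
split; first by move=> m m2; split;
  [exact: resurgence_ge|exact: asymptotic_resurgenceE|exact: gap].
apply/cvgeyPge => B.
(* The gap is at least (2m - 3) / 8, hence at least B once m >= 4B + 2. *)
exists (Num.truncn (4 * `|B| + 2)%R).+2 => // m /= mB.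
apply: le_trans (gap m _); last by apply: leq_trans mB.
have Bm : (4 * `|B| + 2 <= m%:R :> R)%R.
  apply/ltW/(lt_le_trans (truncnS_gt _)); rewrite ler_nat.
  exact: ltnW.
have B0 := ler_norm B; have nB0 := normr_ge0 B.
rewrite lee_fin ler_pdivlMr; last by lra.
by nra.
Qed.
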